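(* Let $A\in\mathbb{R}^{n\times n}$ be nonsingular and let $\omega>0$, $\sigma>0$. If $$\Big||1-\omega|\,\Big|1-\frac{\omega^2}{\sigma}\Big|-\frac{\omega^2|1-\omega|}{\sigma}\Vert A^{-1}\Vert\Vert A\Vert\Big|<1$$ and $$\frac{\omega^2}{\sigma}\Vert A^{-1}\Vert\big(1+|1-\omega|\Vert A\Vert\big)<(1-|1-\omega|)\Big(1-\Big|1-\frac{\omega^2}{\sigma}\Big|\Big),$$ then for any $b\in\mathbb{R}^n$ the equation $Ax-|x|-b=0$ has a unique solution $x^*\in\mathbb{R}^n$, and the sequence $\{x^{(k)}\}_{k=0}^\infty$ generated by the NSOR iteration converges to $x^*$.
   Context: For $x\in\mathbb{R}^n$, $|x|$ is the componentwise absolute value. $\Vert\cdot\Vert$ is the matrix 2-norm. The NSOR iteration for $Ax-|x|-b=0$ with parameters $\omega=\omega_{\rm NSOR}$, $\sigma=\sigma_{\rm NSOR}$ starts from arbitrary $x^{(0)},y^{(0)}\in\mathbb{R}^n$ and is, for $k=0,1,2,\dots$, $$x^{(k+1)}=x^{(k)}+\omega A^{-1}(b-Ax^{(k)}+y^{(k)}),\qquad y^{(k+1)}=y^{(k)}+\frac{\omega}{\sigma}(b+|x^{(k+1)}|-Ax^{(k+1)}).$$ *)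

(* Defs.v *)
(* MathComp-Analysis, over an arbitrary realType. *)
From HB Require Import structures.
From mathcomp Require Import all_boot all_order all_algebra.
From mathcomp Require Import all_classical all_reals all_analysis.

Set Implicit Arguments.
Unset Strict Implicit.
Unset Printing Implicit Defensive.

Import Order.TTheory GRing.Theory Num.Theory numFieldNormedType.Exports.

Local Open Scope classical_set_scope.
Local Open Scope ring_scope.

(* The library norm `|_| on matrices is the max-norm, hence the two dedicated
   norms and the componentwise absolute value below. *)
Definition vnorm2 (R : realType) (n : nat) (x : 'cV[R]_n) : R :=
  Num.sqrt (\sum_(i < n) x i 0 ^+ 2).

(* The set is nonempty (it contains 0) and bounded, so this is a true supremum,
   not the default value of sup. *)
Definition mxnorm2 (R : realType) (m n : nat) (A : 'M[R]_(m, n)) : R :=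
  sup [set vnorm2 (A *m x) | x in [set x : 'cV[R]_n | vnorm2 x <= 1]].

Definition vabs (R : realType) (n : nat) (x : 'cV[R]_n) : 'cV[R]_n :=
  map_mx (fun t : R => `|t|) x.

Definition AVE_solution (R : realType) (n : nat) (A : 'M[R]_n) (b x : 'cV[R]_n)
    : Prop :=
  A *m x - vabs x - b = 0.

(* The y-update uses the already updated x. *)
Definition NSOR_step (R : realType) (n : nat) (A : 'M[R]_n) (b : 'cV[R]_n)
    (omega sigma : R) (xy : 'cV[R]_n * 'cV[R]_n) : 'cV[R]_n * 'cV[R]_n :=
  let x' := xy.1 + omega *: (invmx A *m (b - A *m xy.1 + xy.2)) in
  (x', xy.2 + (omega / sigma) *: (b + vabs x' - A *m x')).

Definition NSOR_x (R : realType) (n : nat) (A : 'M[R]_n) (b : 'cV[R]_n)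
    (omega sigma : R) (x0 y0 : 'cV[R]_n) (k : nat) : 'cV[R]_n :=
  (iter k (NSOR_step A b omega sigma) (x0, y0)).1.

(* Main.v *)
Require Import Defs.
From HB Require Import structures.
From mathcomp Require Import all_boot all_order all_algebra.
From mathcomp Require Import all_classical all_reals all_analysis.
From mathcomp Require Import ring lra.
Import Order.TTheory GRing.Theory Num.Theory numFieldNormedType.Exports.
Local Open Scope classical_set_scope.
Local Open Scope ring_scope.

(** Write p = |1 - omega|, t = omega^2 / sigma, q = |1 - t|, nu = ||A^-1|| and
    a = ||A||, with Euclidean norms. The equation A x - |x| - b = 0 says
    x = A^-1 (b + |x|), and together with y = |x| its solutions are the fixed
    points of the iteration. If xs is one, the errors e = x - xs and
    f = y - |xs| obey
      e' = (1 - omega) e + omega A^-1 f,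
      f' = (1 - t) f + (omega / sigma) (|x'| - |xs|)
           - (omega / sigma) (1 - omega) A e,
    where the second line uses the first one to eliminate A e' from the residual
    of x' (lemmas [NSOR_error_x] and [NSOR_error_y]). The componentwise absolute
    value is 1-Lipschitz, so the pair of norms (||e||, ||f||) is bounded after one
    step by its product with the nonnegative matrix
      M = [ p                          omega nu ]
          [ (omega / sigma) p (1 + a)  q + t nu ].
    Its determinant is p q - t p nu a and its trace is p + q + t nu: the first
    hypothesis is |det M| < 1, and the second one is tr M < 1 + det M. This is the
    classical criterion for both roots of the characteristic polynomial of M to
    lie inside the unit disk.

    Instead of the spectral radius, the proof uses weights. The hypotheses force
    p < 1 and q + t nu < 1 ([diagonal_lt1]), and then some u > 0 and r < 1
    satisfy (u, 1) M <= r (u, 1) ([positive_weights]). So u ||e|| + ||f||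
    decreases at each step by the factor r ([NSOR_contraction]) and x converges
    to xs geometrically ([NSOR_cvg]).

    It remains to solve the equation. Since q >= 1 - t, the inequality
    q + t nu < 1 contains nu < 1, so x |-> A^-1 (b + |x|) is a contraction for
    the Euclidean norm. The topology on column vectors is that of the max norm,
    for which this map need not contract; but the two norms are equivalent, so a
    high enough iterate does, and its fixed point is the solution
    ([vnorm2_contraction_fixpoint], [AVE_unique_solution]). *)

(** * Euclidean norm *)

(** Matrix spaces are Banach spaces for the max norm, as the fixed point theorem
    requires. *)
HB.instance Definition _ (R : realType) (m n : nat) :=
  Uniform_isComplete.Build 'M[R]_(m, n) cauchy_cvg.

(** Lagrange's identity: twice the defect is a sum of squares. *)
Lemma cauchy_schwarz_sum (R : realDomainType) (n : nat) (f g : 'I_n -> R) :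
  (\sum_i f i * g i) ^+ 2 <= (\sum_i f i ^+ 2) * (\sum_i g i ^+ 2).
Proof.
have lagrange : \sum_i \sum_j (f i * g j - f j * g i) ^+ 2 =
    ((\sum_i f i ^+ 2) * (\sum_i g i ^+ 2) - (\sum_i f i * g i) ^+ 2) *+ 2.
  rewrite mulr2n expr2 !big_distrlr /=.
  rewrite [X in _ = (X - _) + _]exchange_big /= -!sumrB -big_split /=.
  rewrite [X in _ = X](eq_bigr (fun i => \sum_j ((f j ^+ 2 * g i ^+ 2
      - f i * g i * (f j * g j)) + (f i ^+ 2 * g j ^+ 2
      - f i * g i * (f j * g j))))).
    by apply: eq_bigr => i _; apply: eq_bigr => j _; ring.
  by move=> i _; rewrite -!sumrB -big_split.
rewrite -subr_ge0 -(pmulrn_lge0 _ (ltn0Sn 1)) -lagrange.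
by apply: sumr_ge0 => i _; apply: sumr_ge0 => j _; exact: sqr_ge0.
Qed.

Section EuclideanNorm.
Context {R : realType} {n : nat}.
Implicit Types x y : 'cV[R]_n.

Lemma sumsqr_ge0 x : 0 <= \sum_i x i 0 ^+ 2.
Proof. by apply: sumr_ge0 => i _; exact: sqr_ge0. Qed.

Lemma vnorm2_ge0 x : 0 <= vnorm2 x.
Proof. exact: sqrtr_ge0. Qed.

Lemma sqr_vnorm2 x : vnorm2 x ^+ 2 = \sum_i x i 0 ^+ 2.
Proof. by rewrite sqr_sqrtr // sumsqr_ge0. Qed.

Lemma vnorm2Z (a : R) x : vnorm2 (a *: x) = `|a| * vnorm2 x.
Proof.
rewrite /vnorm2 (eq_bigr (fun i => a ^+ 2 * x i 0 ^+ 2)).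
  by rewrite -mulr_sumr sqrtrM ?sqr_ge0 // sqrtr_sqr.
by move=> i _; rewrite mxE exprMn.
Qed.

Lemma vnorm2N x : vnorm2 (- x) = vnorm2 x.
Proof. by rewrite -scaleN1r vnorm2Z normrN1 mul1r. Qed.

Lemma vnorm2_0 : vnorm2 (0 : 'cV[R]_n) = 0.
Proof. by rewrite -(scale0r 0) vnorm2Z normr0 mul0r. Qed.

Lemma vnorm2D x y : vnorm2 (x + y) <= vnorm2 x + vnorm2 y.
Proof.
rewrite -(ler_pXn2r (ltn0Sn 1)) ?nnegrE ?addr_ge0 ?vnorm2_ge0 //.
have xy_le : \sum_i x i 0 * y i 0 <= vnorm2 x * vnorm2 y.
  apply: le_trans (ler_norm _) _.
  rewrite -(ler_pXn2r (ltn0Sn 1)) ?nnegrE ?mulr_ge0 ?vnorm2_ge0 //.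
  by rewrite -normrX ger0_norm ?sqr_ge0 // exprMn !sqr_vnorm2 cauchy_schwarz_sum.
have -> : vnorm2 (x + y) ^+ 2 =
    vnorm2 x ^+ 2 + (\sum_i x i 0 * y i 0) *+ 2 + vnorm2 y ^+ 2.
  rewrite !sqr_vnorm2 -sumrMnl -!big_split /=.
  by apply: eq_bigr => i _; rewrite mxE sqrrD.
by rewrite sqrrD lerD2r lerD2l lerMn2r.
Qed.

Lemma coord_le_vnorm2 x i : `|x i 0| <= vnorm2 x.
Proof.
rewrite -sqrtr_sqr ler_wsqrtr // (bigD1 i) //= lerDl.
by apply: sumr_ge0 => j _; exact: sqr_ge0.
Qed.

Lemma vnorm2_le x y : (forall i, `|x i 0| <= `|y i 0|) -> vnorm2 x <= vnorm2 y.
Proof.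
move=> le_xy; rewrite ler_wsqrtr //; apply: ler_sum => i _.
by rewrite -(real_normK (num_real (x i 0))) -(real_normK (num_real (y i 0)))
           lerXn2r ?nnegrE.
Qed.

Lemma vnorm2_vabsB x y : vnorm2 (vabs x - vabs y) <= vnorm2 (x - y).
Proof. by apply: vnorm2_le => i; rewrite !mxE ler_dist_dist. Qed.

(** Here [`|x|] is the max norm, the one that defines the topology. *)
Lemma norm_le_vnorm2 x : `|x| <= vnorm2 x.
Proof.
rewrite [leLHS]/Num.Def.normr /= mx_normrE.
apply: bigmax_le => [|[i j] _]; first exact: vnorm2_ge0.
by rewrite /= (ord1 j) coord_le_vnorm2.
Qed.

Lemma coord_le_norm x i : `|x i 0| <= `|x|.
Proof.
rewrite [leRHS]/Num.Def.normr /= mx_normrE.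
exact: (le_bigmax _ (fun ij : 'I_n * 'I_1 => `|x ij.1 ij.2|) (i, 0)).
Qed.

Lemma vnorm2_le_norm x : vnorm2 x <= Num.sqrt n%:R * `|x|.
Proof.
rewrite -[`|x|]ger0_norm // -sqrtr_sqr -sqrtrM // ler_wsqrtr //.
rewrite mulr_natl -[X in _ *+ X]card_ord -sumr_const ler_sum // => i _.
by rewrite -(real_normK (num_real (x i 0))) lerXn2r ?nnegrE ?coord_le_norm.
Qed.

End EuclideanNorm.

(** * Operator norm *)

Section OperatorNorm.
Context {R : realType} {m n : nat}.
Variable A : 'M[R]_(m, n).

Let unit_image := [set vnorm2 (A *m x) | x in [set x : 'cV[R]_n | vnorm2 x <= 1]].

(** The Frobenius norm is a bound, by Cauchy-Schwarz on each row. It makes the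
    supremum defining [mxnorm2] a genuine one. *)
Lemma has_ubound_unit_image : has_ubound unit_image.
Proof.
exists (Num.sqrt (\sum_i \sum_j A i j ^+ 2)) => _ [x x1 <-].
rewrite ler_wsqrtr //; apply: ler_sum => i _; rewrite mxE.
apply: (le_trans (cauchy_schwarz_sum _ _ _ _)).
rewrite -sqr_vnorm2 ler_piMr ?expr_le1 ?vnorm2_ge0 //.
by apply: sumr_ge0 => j _; exact: sqr_ge0.
Qed.

Lemma mxnorm2_ge0 : 0 <= mxnorm2 A.
Proof.
apply: (ub_le_sup has_ubound_unit_image).
by exists 0; rewrite /= ?mulmx0 vnorm2_0.
Qed.

Lemma vnorm2_mulmx_le (x : 'cV[R]_n) : vnorm2 (A *m x) <= mxnorm2 A * vnorm2 x.
Proof.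
have [x0|x_neq0] := eqVneq (vnorm2 x) 0.
  have -> : x = 0.
    by apply/eqP; rewrite -normr_le0 -x0 norm_le_vnorm2.
  by rewrite mulmx0 !vnorm2_0 mulr0.
have x_gt0 : 0 < vnorm2 x by rewrite lt0r x_neq0 vnorm2_ge0.
have norm_inv : `|(vnorm2 x)^-1| = (vnorm2 x)^-1.
  by rewrite ger0_norm // invr_ge0 ltW.
rewrite -ler_pdivrMr // mulrC -norm_inv -vnorm2Z scalemxAr.
apply: (ub_le_sup has_ubound_unit_image).
by exists ((vnorm2 x)^-1 *: x); rewrite //= vnorm2Z norm_inv mulVf.
Qed.

End OperatorNorm.

(** * Fixed points and convergence for Euclidean contractions *)

Section FixedPoint.
Context {R : realType} {n : nat}.
Variables (F : 'cV[R]_n -> 'cV[R]_n) (r : R).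
Hypotheses (r_ge0 : 0 <= r) (r_lt1 : r < 1).
Hypothesis F_contr : forall x y, vnorm2 (F x - F y) <= r * vnorm2 (x - y).

Lemma iter_vnorm2_contraction k x y :
  vnorm2 (iter k F x - iter k F y) <= r ^+ k * vnorm2 (x - y).
Proof.
elim: k => [|k IHk] /=; first by rewrite mul1r.
by rewrite (le_trans (F_contr _ _)) // exprS -mulrA ler_wpM2l.
Qed.

Lemma vnorm2_le_contr (x : 'cV[R]_n) s :
  s < 1 -> vnorm2 x <= s * vnorm2 x -> x = 0.
Proof.
move=> s1 xs; apply/eqP; rewrite -normr_le0.
apply: (le_trans (norm_le_vnorm2 _)).
have := vnorm2_ge0 x; nra.
Qed.

Lemma vnorm2_contraction_fixpoint_unique x y : x = F x -> y = F y -> x = y.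
Proof.
move=> xF yF; apply/subr0_eq/(vnorm2_le_contr _ _ r_lt1).
by rewrite {1}xF {1}yF.
Qed.

(** The factor r ^ k of the k-th iterate eventually beats the constant sqrt n
    that compares the two norms, so that some iterate is a contraction for the max
    norm. Its fixed point x is also one of F, because F x is fixed by the same
    iterate. *)
Lemma vnorm2_contraction_fixpoint : exists x, x = F x.
Proof.
(* The successor makes the exponent positive, so that r ^+ N.+1 < 1 below. *)
have [N N_small] : exists N, r ^+ N.+1 * Num.sqrt n%:R <= 2^-1.
  have : (r ^+ k * Num.sqrt n%:R : R) @[k --> \oo] --> (0 * Num.sqrt n%:R : R).
    by apply: cvgMl; apply: cvg_expr; rewrite ger0_norm.
  rewrite mul0r => /cvgr0Pnorm_le /(_ 2^-1 ltac:(by rewrite invr_gt0)) [N _ HN].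
  by exists N; apply: le_trans (ler_norm _) (HN N.+1 _) => /=.
pose FN : {fun [set: 'cV[R]_n] >-> [set: 'cV[R]_n]} := totalfun (iter N.+1 F).
have FN_contr : is_contraction FN.
  exists (NngNum (ltac:(by rewrite invr_ge0) : 0 <= 2^-1 :> R)); split => /=.
    by lra.
  move=> [x y] _; change (`|iter N.+1 F x - iter N.+1 F y| <= 2^-1 * `|x - y|).
  apply: (le_trans (norm_le_vnorm2 _)).
  apply: (le_trans (iter_vnorm2_contraction _ _ _)).
  apply: (@le_trans _ _ (r ^+ N.+1 * (Num.sqrt n%:R * `|x - y|))).
    by rewrite ler_wpM2l ?exprn_ge0 ?vnorm2_le_norm.
  by rewrite mulrA ler_wpM2r.
have [x _ xE] := banach_fixed_point FN_contr closedT (ex_intro _ 0 I).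
have {}xE : x = iter N.+1 F x := xE.
exists x; apply/esym/subr0_eq/(vnorm2_le_contr _ (r ^+ N.+1)).
  by rewrite exprn_ilt1.
have FxE : F x = iter N.+1 F (F x) by rewrite -iterSr iterS -xE.
by move: (iter_vnorm2_contraction N.+1 (F x) x); rewrite -FxE -xE.
Qed.

End FixedPoint.

Lemma cvg_geometric_vnorm2 (R : realType) (n : nat) (u : nat -> 'cV[R]_n) l C r :
  0 <= r -> r < 1 -> (forall k, vnorm2 (u k - l) <= C * r ^+ k) -> u @ \oo --> l.
Proof.
move=> r_ge0 r_lt1 u_le; apply/subr_cvg0/norm_cvg0P.
have geo0 : (C * r ^+ k : R) @[k --> \oo] --> (0 : R).
  by apply: cvg_geometric; rewrite ger0_norm.
apply: (squeeze_cvgr _ (cvg_cst 0) geo0).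
by apply: nearW => k; rewrite normr_ge0 (le_trans (norm_le_vnorm2 _)).
Qed.

(** * Scalar estimates for the two-dimensional error recursion *)

(** For the matrix [p s; c d], the row (c / (1 - p), 1) is decreased in its
    second entry by the gap hypothesis, and only preserved in its first one.
    Raising the first weight slightly makes both decreases strict. *)
Lemma positive_weights (R : realFieldType) (p c s d : R) :
  0 <= p -> 0 <= c -> 0 <= s -> 0 <= d -> p < 1 -> s * c < (1 - p) * (1 - d) ->
  exists u r, [/\ 0 < u, 0 <= r, r < 1, u * p + c <= r * u & u * s + d <= r].
Proof.
move=> p_ge0 c_ge0 s_ge0 d_ge0 p_lt1 gap.
have p1 : 0 < 1 - p by rewrite subr_gt0.
(* Spending only the fraction s / (1 + s) of the gap keeps u * s + d < 1. *)
pose e := ((1 - p) * (1 - d) - s * c) / (1 + s).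
have e_gt0 : 0 < e by rewrite divr_gt0 ?subr_gt0 // ltr_wpDr.
have eE : e * (1 + s) = (1 - p) * (1 - d) - s * c.
  by rewrite divfK // gt_eqF // ltr_wpDr.
pose u := (c + e) / (1 - p).
have u_gt0 : 0 < u by rewrite divr_gt0 // ltr_wpDl.
have uE : u * (1 - p) = c + e by rewrite divfK // gt_eqF.
have us : u * s + d < 1.
  rewrite -(ltr_pM2l p1); nra.
exists u, (Num.max (p + c / u) (u * s + d)); split => //.
- by rewrite le_max; apply/orP; right; rewrite addr_ge0 // mulr_ge0 // ltW.
- rewrite gt_max us andbT -(ltr_pM2l u_gt0) mulrDr mulrCA divff ?gt_eqF //; lra.
- apply: (@le_trans _ _ ((p + c / u) * u)).
    by rewrite mulrDl divfK ?gt_eqF // mulrC.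
  by rewrite ler_pM2r // le_max lexx.
- by rewrite le_max lexx orbT.
Qed.

(** The bound t nu (1 + p a) < (1 - p) (1 - q) makes both factors on the right
    have the same strict sign. If both were negative, then
    t p nu a < (p - 1) (q - 1), and the determinant p q - t p nu a would exceed
    p + q - 1 > 1. *)
Lemma diagonal_lt1 (R : realFieldType) (p q t nu a : R) :
  0 <= p -> 0 <= t -> 0 <= nu -> 0 <= a ->
  p * q - t * p * nu * a < 1 -> t * nu * (1 + p * a) < (1 - p) * (1 - q) ->
  p < 1 /\ t * nu < 1 - q.
Proof.
move=> p_ge0 t_ge0 nu_ge0 a_ge0 det_lt1 trace_lt.
have tnu_ge0 : 0 <= t * nu by rewrite mulr_ge0.
have tnupa_ge0 : 0 <= t * nu * (p * a) by rewrite !mulr_ge0.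
have p_lt1 : p < 1.
  rewrite ltNge; apply/negP => p_ge1.
  have q_gt1 : 1 < q by rewrite ltNge; apply/negP => q_le1; nra.
  by lra.
have q_lt1 : q < 1 by rewrite ltNge; apply/negP => q_ge1; nra.
split=> //; nra.
Qed.

(** * The absolute value equation and its NSOR iteration *)

Section AVE.
Context {R : realType} {n : nat}.
Variables (A : 'M[R]_n) (b : 'cV[R]_n).
Hypothesis A_unit : A \in unitmx.

Lemma AVE_solution_fixpoint x :
  AVE_solution A b x <-> x = invmx A *m (b + vabs x).
Proof.
rewrite /AVE_solution; split=> [Ax|xE].
  have -> : b + vabs x = A *m x by apply/esym/subr0_eq; rewrite opprD addrA addrAC.
  by rewrite mulKmx.
by rewrite {1}xE mulKVmx // addrK subrr.
Qed.

Lemma AVE_unique_solution :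
  mxnorm2 (invmx A) < 1 -> exists xs, unique (AVE_solution A b) xs.
Proof.
move=> nu_lt1; pose F x := invmx A *m (b + vabs x).
have F_contr x y : vnorm2 (F x - F y) <= mxnorm2 (invmx A) * vnorm2 (x - y).
  rewrite /F -mulmxBr opprD addrACA subrr add0r.
  apply: (le_trans (vnorm2_mulmx_le _ _)).
  by rewrite ler_wpM2l ?mxnorm2_ge0 ?vnorm2_vabsB.
have [xs xsF] := vnorm2_contraction_fixpoint F _ (mxnorm2_ge0 _) nu_lt1 F_contr.
exists xs; split=> [|x /AVE_solution_fixpoint xF].
  exact/AVE_solution_fixpoint.
exact: vnorm2_contraction_fixpoint_unique nu_lt1 F_contr _ _ xsF xF.
Qed.

Variables (omega sigma : R) (xs : 'cV[R]_n).
Hypothesis xs_sol : AVE_solution A b xs.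
Hypotheses (omega_gt0 : 0 < omega) (sigma_gt0 : 0 < sigma).

Lemma NSOR_error_x xy :
  (NSOR_step A b omega sigma xy).1 - xs =
  (1 - omega) *: (xy.1 - xs) + omega *: (invmx A *m (xy.2 - vabs xs)).
Proof.
have xsE := (AVE_solution_fixpoint xs).1 xs_sol.
rewrite /NSOR_step /= {1}xsE !mulmxDr !mulmxN mulKmx //.
have -> : invmx A *m b = xs - invmx A *m vabs xs.
  by apply/eqP; rewrite eq_sym subr_eq -mulmxDr -xsE.
by apply/colP => i; rewrite !mxE; ring.
Qed.

Lemma NSOR_error_y xy (xy' := NSOR_step A b omega sigma xy) :
  xy'.2 - vabs xs =
  (1 - omega ^+ 2 / sigma) *: (xy.2 - vabs xs)
  + (omega / sigma) *: (vabs xy'.1 - vabs xs)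
  - (omega / sigma * (1 - omega)) *: (A *m (xy.1 - xs)).
Proof.
have -> : xy'.2 = xy.2 + (omega / sigma) *: (b + vabs xy'.1 - A *m xy'.1) by [].
have /(congr1 (mulmx A)) := NSOR_error_x xy.
rewrite -/xy'; move: (xy'.1) => {xy'} x'.
rewrite mulmxBr mulmxDr -!scalemxAr mulKVmx // => /eqP.
rewrite subr_eq => /eqP ->.
have {1}-> : b = A *m xs - vabs xs by apply/esym/subr0_eq.
apply/colP => i.
move: (vabs x') (vabs xs) (A *m _) (A *m _) => u v w z.
by rewrite !mxE; ring.
Qed.

(** The two hypotheses on u and r say that the row (u, 1) times the comparison
    matrix M is at most r (u, 1). *)
Lemma NSOR_contraction (u r : R) xy (xy' := NSOR_step A b omega sigma xy) :
  0 <= u ->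
  u * `|1 - omega| + omega / sigma * (`|1 - omega| * (1 + mxnorm2 A)) <= r * u ->
  u * (omega * mxnorm2 (invmx A))
    + (`|1 - omega ^+ 2 / sigma| + omega ^+ 2 / sigma * mxnorm2 (invmx A)) <= r ->
  u * vnorm2 (xy'.1 - xs) + vnorm2 (xy'.2 - vabs xs) <=
  r * (u * vnorm2 (xy.1 - xs) + vnorm2 (xy.2 - vabs xs)).
Proof.
move=> u_ge0 ux uy.
set X := vnorm2 (xy.1 - xs); set Y := vnorm2 (xy.2 - vabs xs).
have X_ge0 : 0 <= X := vnorm2_ge0 _.
have Y_ge0 : 0 <= Y := vnorm2_ge0 _.
have c_ge0 : 0 <= omega / sigma by rewrite divr_ge0 // ltW.
have X'_le : vnorm2 (xy'.1 - xs) <=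
    `|1 - omega| * X + omega * (mxnorm2 (invmx A) * Y).
  rewrite NSOR_error_x (le_trans (vnorm2D _ _)) // !vnorm2Z lerD2l.
  by rewrite (gtr0_norm omega_gt0) ler_pM2l //; exact: vnorm2_mulmx_le.
have Y'_le : vnorm2 (xy'.2 - vabs xs) <= `|1 - omega ^+ 2 / sigma| * Y
    + omega / sigma * vnorm2 (xy'.1 - xs)
    + omega / sigma * `|1 - omega| * (mxnorm2 A * X).
  rewrite NSOR_error_y (le_trans (vnorm2D _ _)) // vnorm2N lerD //.
    rewrite (le_trans (vnorm2D _ _)) // !vnorm2Z lerD2l (ger0_norm c_ge0).
    by rewrite ler_wpM2l ?vnorm2_vabsB.
  rewrite vnorm2Z normrM (ger0_norm c_ge0).
  apply: ler_wpM2l; first by rewrite mulr_ge0.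
  exact: vnorm2_mulmx_le.
(* The norm of the new x-error enters with weight u in the sum and with weight
   omega / sigma in the bound of the new y-error. *)
have uX'_le := ler_wpM2l (addr_ge0 u_ge0 c_ge0) X'_le.
have uxX := ler_wpM2r X_ge0 ux.
have uyY := ler_wpM2r Y_ge0 uy.
have tE : omega ^+ 2 / sigma = omega / sigma * omega by ring.
move: X'_le Y'_le uX'_le uxX uyY; rewrite tE.
lra.
Qed.

Lemma NSOR_cvg (u r : R) :
  0 < u -> 0 <= r -> r < 1 ->
  u * `|1 - omega| + omega / sigma * (`|1 - omega| * (1 + mxnorm2 A)) <= r * u ->
  u * (omega * mxnorm2 (invmx A))
    + (`|1 - omega ^+ 2 / sigma| + omega ^+ 2 / sigma * mxnorm2 (invmx A)) <= r ->
  forall x0 y0, NSOR_x A b omega sigma x0 y0 @ \oo --> xs.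
Proof.
move=> u_gt0 r_ge0 r_lt1 ux uy x0 y0.
pose E xy := u * vnorm2 (xy.1 - xs) + vnorm2 (xy.2 - vabs xs).
have E_le k : E (iter k (NSOR_step A b omega sigma) (x0, y0)) <= E (x0, y0) * r ^+ k.
  elim: k => [|k IHk] /=; first by rewrite mulr1.
  apply: (le_trans (NSOR_contraction _ _ _ (ltW u_gt0) ux uy)).
  by rewrite exprSr mulrA mulrC ler_wpM2r.
apply: (cvg_geometric_vnorm2 _ _ _ _ (E (x0, y0) / u) r r_ge0 r_lt1) => k.
rewrite mulrAC ler_pdivlMr // mulrC; apply: le_trans (E_le k).
by rewrite lerDl vnorm2_ge0.
Qed.

End AVE.

Theorem corollary17 (R : realType) (n : nat) (A : 'M[R]_n) (omega sigma : R)
  (hA : A \in unitmx) (homega : 0 < omega) (hsigma : 0 < sigma)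
  (h1 : `| `|1 - omega| * `|1 - omega ^+ 2 / sigma|
           - omega ^+ 2 * `|1 - omega| / sigma
             * mxnorm2 (invmx A) * mxnorm2 A | < 1)
  (h2 : omega ^+ 2 / sigma * mxnorm2 (invmx A)
          * (1 + `|1 - omega| * mxnorm2 A)
        < (1 - `|1 - omega|) * (1 - `|1 - omega ^+ 2 / sigma|))
  (b : 'cV[R]_n) :
  exists xs : 'cV[R]_n,
    unique (AVE_solution A b) xs /\
    forall x0 y0 : 'cV[R]_n,
      NSOR_x A b omega sigma x0 y0 @ \oo --> xs.
Proof.
have nu_ge0 := mxnorm2_ge0 (invmx A); have a_ge0 := mxnorm2_ge0 A.
have p_ge0 := normr_ge0 (1 - omega).
have q_ge0 := normr_ge0 (1 - omega ^+ 2 / sigma).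
have t_gt0 : 0 < omega ^+ 2 / sigma by rewrite divr_gt0 ?exprn_gt0.
have [p_lt1 tnu_lt] : `|1 - omega| < 1 /\
    omega ^+ 2 / sigma * mxnorm2 (invmx A) < 1 - `|1 - omega ^+ 2 / sigma|.
  apply: (diagonal_lt1 _ _ _ _ _ (mxnorm2 A)) => //; first exact: ltW.
  have -> : omega ^+ 2 / sigma * `|1 - omega| = omega ^+ 2 * `|1 - omega| / sigma.
    by rewrite mulrAC.
  exact: le_lt_trans (ler_norm _) h1.
(* Here q >= 1 - t turns t nu < 1 - q into t nu < t. *)
have nu_lt1 : mxnorm2 (invmx A) < 1.
  rewrite -(ltr_pM2l t_gt0) mulr1; apply: lt_le_trans tnu_lt _.
  by rewrite lerBlDr -lerBlDl ler_norm.
have [xs xs_uniq] := AVE_unique_solution A b hA nu_lt1.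
exists xs; split=> // x0 y0.
have [u [r [u_gt0 r_ge0 r_lt1 ux uy]]] : exists u r, [/\ 0 < u, 0 <= r, r < 1,
    u * `|1 - omega| + omega / sigma * (`|1 - omega| * (1 + mxnorm2 A)) <= r * u
  & u * (omega * mxnorm2 (invmx A))
    + (`|1 - omega ^+ 2 / sigma| + omega ^+ 2 / sigma * mxnorm2 (invmx A)) <= r].
  have w_ge0 : 0 <= omega := ltW homega.
  have s_ge0 : 0 <= sigma := ltW hsigma.
  have t_ge0 := ltW t_gt0.
  apply: positive_weights => //.
  - by rewrite !mulr_ge0 ?invr_ge0 ?addr_ge0.
  - by rewrite mulr_ge0.
  - by rewrite addr_ge0 // mulr_ge0.
  have -> : omega * mxnorm2 (invmx A)
      * (omega / sigma * (`|1 - omega| * (1 + mxnorm2 A))) =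
    omega ^+ 2 / sigma * mxnorm2 (invmx A) * (`|1 - omega| * (1 + mxnorm2 A)).
    by ring.
  by lra.
exact: (NSOR_cvg A b hA _ _ _ xs_uniq.1 homega hsigma u r).
Qed.
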